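(* For any non-zero spinor $\psi\in\Delta_7^0$ there exists a unique $3$-form $\mathrm{T}$ on $\mathbb{R}^7$ of the form $$\mathrm{T}=\sum_{i,j\in\{1,2,7\}}x_{ij}\,e_i\wedge de_j+w\,e_1\wedge e_2\wedge e_7,\qquad x_{ij},w\in\mathbb{R},$$ such that $(X-2\,X\lrcorner\,\mathrm{T})\cdot\psi=0$ holds for any vector $X\in\mathbb{R}^7$.
   Context: $e_1,\dots,e_7$ is the standard orthonormal basis of $\mathbb{R}^7$, $e_{ij}=e_i\wedge e_j$. $\mathrm{SU}(2)\subset\mathrm{G}_2\subset\mathrm{SO}(7)$ is the subgroup fixing $e_1,e_2,e_7$ whose Lie algebra is spanned by the $2$-forms $e_{34}+e_{56}$, $e_{35}-e_{46}$, $e_{36}+e_{45}$. $\Delta_7$ is the real $8$-dimensional spin representation (the Clifford algebra of $\mathbb{R}^7$, with $X\cdot X=-\|X\|^2$, acts on it; $e_i\wedge e_j$ acts as $e_i\cdot e_j$ for $i\neq j$). Under $\mathrm{SU}(2)$ it splits as $\Delta_7=\Delta_7^0\oplus\Delta_7^1$ with $\Delta_7^0$ a $4$-dimensional trivial representation (the spinors annihilated by $\mathfrak{su}(2)$) and $\Delta_7^1$ the non-trivial $4$-dimensional representation. The $\mathrm{SU}(2)$-invariant $2$-forms are denoted $de_1:=e_{35}+e_{46}$, $de_2:=e_{45}-e_{36}$, $de_7:=e_{34}-e_{56}$ (symbols only, not exterior derivatives). The $3$-forms of the stated type are $\mathrm{SU}(2)$-invariant. $\lrcorner$ is the interior product.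 *)

(* Defs.v *)
From HB Require Import structures.
From mathcomp Require Import all_boot all_order all_algebra.
From mathcomp Require Import boolp functions reals.
Set Implicit Arguments.
Unset Strict Implicit.
Unset Printing Implicit Defensive.
Import Order.TTheory GRing.Theory Num.Theory.
Local Open Scope ring_scope.

(* Forms are multilinear functions on R^7 that vanish on repeated arguments;
   the carriers below are plain functions (with the pointwise R-module
   structure) and is_form3 is the defining predicate.  R^o is R seen as a
   module over itself.  Vectors are identified with 1-forms through the
   Euclidean inner product. *)
Notation vec R := 'rV[R]_7.
Notation form1 R := (vec R -> R^o).
Notation form2 R := (vec R -> vec R -> R^o).
Notation form3 R := (vec R -> vec R -> vec R -> R^o).

Definition dot (R : realType) (X Y : vec R) : R := \sum_(i < 7) X 0 i * Y 0 i.

(* 1-based: the standard basis is e 1, ..., e 7. *)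
Definition e (R : realType) (k : nat) : vec R := \row_(i < 7) (i.+1 == k)%:R.

Definition is_form3 (R : realType) (T : form3 R) : Prop :=
  [/\ forall Y Z, linear (fun X => T X Y Z),
      forall X Z, linear (fun Y => T X Y Z),
      forall X Y, linear (fun Z => T X Y Z),
      forall X Z, T X X Z = 0
    & forall X Z, T X Z Z = 0].

(* Convention: (a /\ b)(X, Y) = a(X) b(Y) - a(Y) b(X), so that
   (e_i /\ e_j)(e_i, e_j) = 1 and (e_i /\ e_j /\ e_k)(e_i, e_j, e_k) = 1. *)
Definition wedge11 (R : realType) (a b : form1 R) : form2 R :=
  fun X Y => a X * b Y - a Y * b X.

Definition wedge12 (R : realType) (a : form1 R) (b : form2 R) : form3 R :=
  fun X Y Z => a X * b Y Z - a Y * b X Z + a Z * b X Y.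

Definition e2 (R : realType) (i j : nat) : form2 R :=
  wedge11 (dot (e R i)) (dot (e R j)).
Arguments e2 : clear implicits.

Definition interior (R : realType) (X : vec R) (T : form3 R) : form2 R :=
  fun Y Z => T X Y Z.

(* Meaningful for j in {1, 2, 7} only. *)
Definition de (R : realType) (j : nat) : form2 R :=
  match j with
  | 1 => e2 R 3 5 + e2 R 4 6
  | 2 => e2 R 4 5 - e2 R 3 6
  | 7 => e2 R 3 4 - e2 R 5 6
  | _ => 0
  end.
Arguments de : clear implicits.

Definition su2 (R : realType) (omega : form2 R) : Prop :=
  exists a b c : R,
    omega = a *: (e2 R 3 4 + e2 R 5 6) + b *: (e2 R 3 5 - e2 R 4 6)
            + c *: (e2 R 3 6 + e2 R 4 5).

(* Up to isomorphism the Clifford algebra of R^7 with X.X = -|X|^2 has two real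
   modules of dimension 8, interchanged by X |-> -X; both restrict to the
   spin representation of Spin(7).  A map satisfying this predicate is a
   choice of one of them, realised on column vectors. *)
Definition is_clifford (R : realType) (c : {linear vec R -> 'M[R]_8}) : Prop :=
  forall X : vec R, c X *m c X = (- dot X X)%:M.

Notation spinor R := 'cV[R]_8.

Section CliffordAction.
Variables (R : realType) (c : {linear vec R -> 'M[R]_8}).

Definition cliff1 (X : vec R) (psi : spinor R) : spinor R := c X *m psi.

Definition cliff2 (omega : form2 R) (psi : spinor R) : spinor R :=
  \sum_(1 <= i < 8) \sum_(i.+1 <= j < 8)
     omega (e R i) (e R j) *: cliff1 (e R i) (cliff1 (e R j) psi).

Definition spin0 (psi : spinor R) : Prop :=
  forall omega : form2 R, su2 omega -> cliff2 omega psi = 0.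

End CliffordAction.

Definition has_stated_type (R : realType) (T : form3 R) : Prop :=
  exists (x : nat -> nat -> R) (w : R),
    T = \sum_(i <- [:: 1; 2; 7]%N) \sum_(j <- [:: 1; 2; 7]%N)
          x i j *: wedge12 (dot (e R i)) (de R j)
        + w *: wedge12 (dot (e R 1)) (e2 R 2 7).

(* Main.v *)
From HB Require Import structures.
Require Import Defs.
From mathcomp Require Import all_boot all_order all_algebra.
From mathcomp Require Import boolp functions reals.
From mathcomp Require Import ring lra.
Import Order.TTheory GRing.Theory Num.Theory.
Set Implicit Arguments.
Unset Strict Implicit.
Local Open Scope ring_scope.

(** Everything rests on the quaternions.  Put I_1 = e_3 e_5, I_2 = e_4 e_5 and
    I_7 = e_3 e_4 in the Clifford algebra.  They are anticommuting square roots
    of -1, so 1, I_1, I_2, I_7 span a copy of the quaternions, which commutes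
    with e_1, e_2, e_7.  With the volume element vol4 = e_3 e_4 e_5 e_6 of the
    moved directions, the generators of su(2) are I_j (1 - vol4) and the form
    de_j acts as I_j (1 + vol4).  Hence the invariant spinors are those fixed by
    vol4 ([spin0_vol4]), and on them de_j is 2 I_j.

    Let psi be such a spinor, psi <> 0.  Since e_3 anticommutes with vol4, the
    fixed space of vol4 is half of the spinor space and has dimension 4; hence
    it is the quaternionic line through psi ([quat_span]).  So an operator M
    that commutes with vol4 and the I_j satisfies M psi = q psi for a quaternion
    q, and M M = s forces q^2 = s ([commutant_quat]).  For M = e_i with i in
    {1, 2, 7} this gives e_i psi = q_i psi, where
    q_i = a_i1 I_1 + a_i2 I_2 + a_i7 I_7 is imaginary of norm 1
    ([fixed_coef]).  For M = e_1 e_2 e_7, whose square is 1, it gives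
    e_1 e_2 e_7 psi = eps psi with eps = 1 or -1 ([vol3_sign]).

    Write X_i = x_i1 I_1 + x_i2 I_2 + x_i7 I_7.  Contracting T with a fixed basis
    vector e_i, the equation becomes (1 + 2 w eps) q_i psi = 4 X_i psi, that is,
    4 x_ij = (1 + 2 w eps) a_ij ([kills_fixedE]).  Contracting with a moved basis
    vector e_k and cancelling e_k, it becomes
    psi = -2 (X_1 q_1 + X_2 q_2 + X_7 q_7) psi, whichever k is chosen
    ([kills_movedE]).  As q_i^2 = -1, the first family turns the second into
    1 = (3/2) (1 + 2 w eps).  So the unique solution is w = - eps / 6 and
    x_ij = a_ij / 6 ([kills_statedE]). *)

(** SU(2) fixes [e 1], [e 2], [e 7] and moves the other basis vectors.  The three
    forms [de j] carry the same labels 1, 2, 7. *)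
Local Notation fixed_dirs := [:: 1; 2; 7]%N.
Local Notation moved_dirs := [:: 3; 4; 5; 6]%N.

(** * Vectors and forms *)

Section Euclidean.
Variable R : realType.
Implicit Types X Y Z : vec R.

Lemma dot_is_linear X : linear (dot X : vec R -> R^o).
Proof.
move=> a Y Z; rewrite /dot scaler_sumr -big_split; apply: eq_bigr => i _.
by rewrite !mxE /= mulrDr mulrCA.
Qed.

Lemma dotC X Y : dot X Y = dot Y X.
Proof. by apply: eq_bigr => i _; rewrite mulrC. Qed.

Lemma dotDr X Y Z : dot X (Y + Z) = dot X Y + dot X Z.
Proof. by have := dot_is_linear X 1 Y Z; rewrite !scale1r. Qed.

Lemma dot_e (k : 'I_7) X : dot (e R k.+1) X = X 0 k.
Proof.
rewrite /dot (bigD1 k) //= mxE eqxx mul1r big1 ?addr0 // => i.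
by rewrite -val_eqE mxE eqSS => /negbTE ->; rewrite mul0r.
Qed.

Lemma dot_ee i j : (0 < i < 8)%N -> dot (e R i) (e R j) = (i == j)%:R.
Proof.
case: i => [|i] // lti7; have ->: i = Ordinal (lti7 : (i < 7)%N) by [].
by rewrite dot_e mxE.
Qed.

Lemma vec_sum_e X : X = \sum_(1 <= k < 8) dot (e R k) X *: e R k.
Proof.
rewrite big_add1 big_mkord; apply/rowP=> i; rewrite summxE (bigD1 i) //=.
rewrite dot_e !mxE eqxx mulr1 big1 ?addr0 // => k.
by rewrite -val_eqE !mxE eqSS eq_sym => /negbTE ->; rewrite mulr0.
Qed.

(** The vector dual to a 1-form.  It is built from the values on the basis, the
    only ones that Clifford multiplication by a 2-form uses; thus linearity of
    the 1-form never has to be carried along. *)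
Definition sharp (a : form1 R) : vec R := \row_(i < 7) a (e R i.+1).

Lemma sharp_dot X : sharp (dot X) = X.
Proof. by apply/rowP=> i; rewrite mxE dotC dot_e. Qed.

Lemma sharpD a b : sharp (a + b) = sharp a + sharp b.
Proof. by apply/rowP=> i; rewrite !mxE. Qed.

Lemma sharpB a b : sharp (a - b) = sharp a - sharp b.
Proof. by apply/rowP=> i; rewrite !mxE. Qed.

Lemma sharp_wedge X Y Z :
  sharp (wedge11 (dot X) (dot Y) Z) = dot X Z *: Y - dot Y Z *: X.
Proof.
apply/rowP=> i; rewrite !mxE /wedge11 ![dot _ (e R i.+1)]dotC !dot_e.
by rewrite [X 0 i * _]mulrC.
Qed.

Lemma sharp_sum a : sharp a = \sum_(1 <= k < 8) a (e R k) *: e R k.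
Proof.
rewrite [LHS]vec_sum_e; apply: eq_big_nat => -[|k] // ltk7.
have ->: k = Ordinal (ltk7 : (k < 7)%N) by [].
by rewrite dot_e mxE.
Qed.

Lemma contract_wedge12 X (a : form1 R) (b : form2 R) :
  interior X (wedge12 a b) = a X *: b - wedge11 a (b X).
Proof.
apply/funext=> Y; apply/funext=> Z.
rewrite /interior /wedge12 /wedge11 !fctE /=.
rewrite -[_ *: _]/(a X * b Y Z); ring.
Qed.

Definition is_form2 (b : form2 R) :=
  [/\ forall Y, linear (fun X => b X Y), forall X, linear (b X)
    & forall X, b X X = 0].

Lemma is_form2_e2 i j : is_form2 (e2 R i j).
Proof.
have D := dot_is_linear.
split=> [Y a X Z|X a Y Z|X]; rewrite /e2 /wedge11 ?D /=; last ring.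
  rewrite -![_ *: _]/(_ * _ : R); ring.
rewrite -![_ *: _]/(_ * _ : R); ring.
Qed.

Lemma is_form2D (a b : form2 R) : is_form2 a -> is_form2 b -> is_form2 (a + b).
Proof.
move=> [al ar aa] [bl br bb]; split=> [Y s X Z|X s Y Z|X]; rewrite !fctE.
- by rewrite al bl scalerDr addrACA.
- by rewrite ar br scalerDr addrACA.
- by rewrite aa bb addr0.
Qed.

Lemma is_form2N (a : form2 R) : is_form2 a -> is_form2 (- a).
Proof.
move=> [al ar aa]; split=> [Y s X Z|X s Y Z|X]; rewrite !fctE.
- by rewrite al opprD scalerN.
- by rewrite ar opprD scalerN.
- by rewrite aa oppr0.
Qed.

Lemma is_form2_de j : is_form2 (de R j).
Proof.
have z : is_form2 0.
  rewrite -(subrr (e2 R 1 1)); apply: is_form2D; last apply: is_form2N;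
    exact: is_form2_e2.
have D := is_form2D (is_form2_e2 _ _) (is_form2_e2 _ _).
have B := is_form2D (is_form2_e2 _ _) (is_form2N (is_form2_e2 _ _)).
by case: j => [|[|[|[|[|[|[|[|j]]]]]]]] /=.
Qed.

Lemma is_form3_wedge12 X b : is_form2 b -> is_form3 (wedge12 (dot X) b).
Proof.
have D := dot_is_linear.
move=> [bl br bb]; split.
- move=> Y Z a U W; rewrite /wedge12 D !bl.
  rewrite -![_ *: _]/(_ * _ : R); ring.
- move=> Y Z a U W; rewrite /wedge12 D bl br.
  rewrite -![_ *: _]/(_ * _ : R); ring.
- move=> Y Z a U W; rewrite /wedge12 D !br.
  rewrite -![_ *: _]/(_ * _ : R); ring.
- by move=> Y Z; rewrite /wedge12 bb; ring.
- by move=> Y Z; rewrite /wedge12 bb; ring.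
Qed.

Lemma is_form3_comb a (T U : form3 R) :
  is_form3 T -> is_form3 U -> is_form3 (a *: T + U).
Proof.
move=> [T1 T2 T3 T4 T5] [U1 U2 U3 U4 U5].
split=> [Y Z s V W|Y Z s V W|Y Z s V W|Y Z|Y Z]; rewrite !fctE.
- by rewrite T1 U1; rewrite -![_ *: _]/(_ * _ : R); ring.
- by rewrite T2 U2; rewrite -![_ *: _]/(_ * _ : R); ring.
- by rewrite T3 U3; rewrite -![_ *: _]/(_ * _ : R); ring.
- by rewrite T4 U4 scaler0 addr0.
- by rewrite T5 U5 scaler0 addr0.
Qed.

Lemma is_form3_0 : is_form3 (0 : form3 R).
Proof.
have lin0 s : 0 = s *: (0 : R^o) + 0 by rewrite scaler0 addr0.
by split=> // ? ? s ? ?; exact: lin0.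
Qed.

Definition stated_form (x : nat -> nat -> R) w : form3 R :=
  \sum_(i <- fixed_dirs) \sum_(j <- fixed_dirs)
          x i j *: wedge12 (dot (e R i)) (de R j)
        + w *: wedge12 (dot (e R 1)) (e2 R 2 7).

Lemma is_form3_stated x w : is_form3 (stated_form x w).
Proof.
rewrite /stated_form addrC; apply: is_form3_comb.
  exact/is_form3_wedge12/is_form2_e2.
rewrite big_seq; elim/big_rec: _ => [|i T iS HT]; first exact: is_form3_0.
rewrite -[X in X + T]scale1r; apply: is_form3_comb => //.
elim/big_rec: _ => [|j U _ HU]; first exact: is_form3_0.
apply: is_form3_comb => //; exact/is_form3_wedge12/is_form2_de.
Qed.

End Euclidean.

(** * The Clifford relations *)

Lemma exchange_big_triangle (V : nmodType) m n (F : nat -> nat -> V) :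
  \sum_(m <= i < n) \sum_(m <= j < i) F i j =
  \sum_(m <= j < n) \sum_(j.+1 <= i < n) F i j.
Proof.
transitivity (\sum_(m <= i < n) \sum_(m <= j < n | (j < i)%N) F i j).
  apply: eq_big_nat => i /andP[_ lt_in].
  by rewrite (big_nat_widen _ _ _ _ _ (ltnW lt_in)).
rewrite (exchange_big_dep_nat xpredT) //=.
apply: eq_big_nat => j /andP[le_mj _]; rewrite [RHS](big_nat_widenl _ m) //.
exact: leqW.
Qed.

Section Clifford.
Variables (R : realType) (c : {linear vec R -> 'M[R]_8}).
Hypothesis hc : is_clifford c.
Implicit Types X Y Z : vec R.

Lemma clifford_polar X Y : c X * c Y + c Y * c X = (- (2 * dot X Y))%:M.
Proof.
have := hc (X + Y).
rewrite linearD !dotDr ![dot (_ + _) _]dotC !dotDr [dot Y X]dotC.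
rewrite -[_ *m _]/((c X + c Y) * (c X + c Y)) mulrDl !mulrDr.
rewrite -[c X * c X]/(c X *m c X) -[c Y * c Y]/(c Y *m c Y) !hc => EQ.
apply: (addrI (- dot X X)%:M); apply: (addIr (- dot Y Y)%:M).
rewrite addrA -[LHS]addrA EQ -!raddfD /=; congr (_%:M); ring.
Qed.

Definition gam k := c (e R k).

Lemma gam_sqr i : (0 < i < 8)%N -> gam i * gam i = -1.
Proof.
by move=> lti8; rewrite -[LHS]/(gam i *m gam i) hc dot_ee // eqxx raddfN.
Qed.

Lemma gam_anticomm i j : (0 < i < 8)%N -> i != j ->
  gam i * gam j = - (gam j * gam i).
Proof.
move=> lti8 neij; apply/eqP; rewrite -addr_eq0 clifford_polar dot_ee //.
by rewrite (negbTE neij) mulr0 oppr0 raddf0.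
Qed.

(** Clifford multiplication by a 2-form as a matrix, so that the action on
    spinors can be computed in the matrix ring. *)
Definition cliff2_mx (omega : form2 R) : 'M[R]_8 :=
  \sum_(1 <= i < 8) \sum_(i.+1 <= j < 8)
     omega (e R i) (e R j) *: (gam i * gam j).

Lemma cliff2E omega psi : cliff2 c omega psi = cliff2_mx omega *m psi.
Proof.
rewrite mulmx_suml; apply: eq_bigr => i _; rewrite mulmx_suml.
by apply: eq_bigr => j _; rewrite -scalemxAl -mulmxA.
Qed.

Lemma cliff2_mx_is_linear : linear (cliff2_mx : form2 R -> 'M[R]_8).
Proof.
move=> a u v; rewrite scaler_sumr -big_split; apply: eq_bigr => i _.
rewrite scaler_sumr -big_split; apply: eq_bigr => j _.
by rewrite /= scalerA -scalerDl.
Qed.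

HB.instance Definition _ :=
  GRing.isLinear.Build R (form2 R) 'M[R]_8 *:%R cliff2_mx cliff2_mx_is_linear.

Lemma cliff2_mxD u v : cliff2_mx (u + v) = cliff2_mx u + cliff2_mx v.
Proof. exact: linearD. Qed.

Lemma cliff2_mxB u v : cliff2_mx (u - v) = cliff2_mx u - cliff2_mx v.
Proof. exact: linearB. Qed.

Lemma c_sharp a : c (sharp a) = \sum_(1 <= k < 8) a (e R k) *: gam k.
Proof.
by rewrite sharp_sum linear_sum; apply: eq_bigr => k _; rewrite linearZ.
Qed.

(** This is a /\ b = a b + <a, b>: in the product of the two vectors the diagonal
    terms add up to minus the inner product, and the terms below the diagonal
    fold onto those above it by anticommutation. *)
Lemma cliff2_mx_wedge11 (a b : form1 R) :
  cliff2_mx (wedge11 a b) =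
    c (sharp a) * c (sharp b) + (dot (sharp a) (sharp b))%:M.
Proof.
set M := fun i j => (a (e R i) * b (e R j)) *: (gam i * gam j).
have -> : c (sharp a) * c (sharp b) = \sum_(1 <= i < 8) \sum_(1 <= j < 8) M i j.
  rewrite !c_sharp mulr_suml; apply: eq_bigr => i _; rewrite mulr_sumr.
  by apply: eq_bigr => j _; rewrite -scalerAl -scalerAr scalerA.
have -> : (dot (sharp a) (sharp b))%:M = - \sum_(1 <= i < 8) M i i.
  rewrite -sumrN [in RHS]big_add1 big_mkord raddf_sum; apply: eq_bigr => i _ /=.
  have lti8 : (0 < i.+1 < 8)%N by case: i.
  by rewrite !mxE /M gam_sqr // scalerN opprK -scalemx1.
have -> : \sum_(1 <= i < 8) \sum_(1 <= j < 8) M i j =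
    \sum_(1 <= i < 8)
      (\sum_(1 <= j < i) M i j + M i i + \sum_(i.+1 <= j < 8) M i j).
  apply: eq_big_nat => i /andP[ge1i lti8].
  by rewrite (big_cat_nat ge1i (ltnW lti8)) /= (big_ltn lti8) addrA.
rewrite !big_split /= exchange_big_triangle addrAC addrK -big_split.
apply: eq_big_nat => i /andP[ge1i lti8]; rewrite -big_split.
apply: eq_big_nat => j /andP[lt_ij ltj8] /=.
rewrite /M [gam j * gam i]gam_anticomm ?(leq_trans _ lt_ij) ?ltj8 ?gtn_eqF //.
by rewrite scalerN /wedge11 scalerBl addrC [a (e R j) * _]mulrC.
Qed.

(** * Quaternions and volume elements *)

(** Normal form of products of basis vectors: sort the factors by transposing
    adjacent ones and cancel equal neighbours. *)
Ltac sort_gam :=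
  rewrite ?mulrA;
  repeat (match goal with
  | |- context [gam ?i * gam ?j] =>
      match eval compute in (j < i)%N with
      | true => rewrite (@gam_anticomm i j isT isT)
      | false => match eval compute in (j == i) with
                 | true => rewrite (@gam_sqr i isT) end
      end
  | |- context [?x * gam ?i * gam ?j] =>
      match eval compute in (j < i)%N with
      | true => rewrite -(mulrA x (gam i) (gam j)) (@gam_anticomm i j isT isT)
      | false => match eval compute in (j == i) with
                 | true => rewrite -(mulrA x (gam i) (gam j)) (@gam_sqr i isT) end
      end
  end; rewrite ?mulrN ?mulNr ?opprK ?mulr1 ?mul1r ?mulrA).

(** The imaginary quaternion units, labelled like the forms [de j]; each is
    the leading term of [de j], up to the factor [1 + vol4]. *)
Definition unitq j : 'M[R]_8 :=
  match j with
  | 1 => gam 3 * gam 5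
  | 2 => gam 4 * gam 5
  | 7 => gam 3 * gam 4
  | _ => 0
  end.

Definition vol4 : 'M[R]_8 := gam 3 * gam 4 * gam 5 * gam 6.

Definition vol3 : 'M[R]_8 := gam 1 * gam 2 * gam 7.

Ltac cases_dirs :=
  let H := fresh in
  move=> H; rewrite !inE in H;
  repeat (case/orP: H => H); move/eqP: H => ->.

Lemma vol4_gam_fixed i : i \in fixed_dirs -> vol4 * gam i = gam i * vol4.
Proof. by cases_dirs; rewrite /vol4; sort_gam. Qed.

Lemma vol4_gam_moved k : k \in moved_dirs -> vol4 * gam k = - (gam k * vol4).
Proof. by cases_dirs; rewrite /vol4; sort_gam. Qed.

Lemma vol4_unitq j : j \in fixed_dirs -> vol4 * unitq j = unitq j * vol4.
Proof. by cases_dirs; rewrite /vol4 /unitq; sort_gam. Qed.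

Lemma unitq_gam_fixed i j : i \in fixed_dirs -> j \in fixed_dirs ->
  unitq j * gam i = gam i * unitq j.
Proof. by cases_dirs; cases_dirs; rewrite /unitq; sort_gam. Qed.

Lemma vol4_vol3 : vol4 * vol3 = vol3 * vol4.
Proof. by rewrite /vol4 /vol3; sort_gam. Qed.

Lemma unitq_vol3 j : j \in fixed_dirs -> unitq j * vol3 = vol3 * unitq j.
Proof. by cases_dirs; rewrite /unitq /vol3; sort_gam. Qed.

Lemma vol3_sqr : vol3 * vol3 = 1.
Proof. by rewrite /vol3; sort_gam. Qed.

Lemma unitq_sqr j : j \in fixed_dirs -> unitq j * unitq j = -1.
Proof. by cases_dirs; rewrite /unitq; sort_gam. Qed.

Lemma unitq_anticomm j k : j \in fixed_dirs -> k \in fixed_dirs -> j != k ->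
  unitq j * unitq k = - (unitq k * unitq j).
Proof. by cases_dirs; cases_dirs => //; rewrite /unitq => _; sort_gam. Qed.

Lemma cliff2_mx_e2 i j : (0 < i < 8)%N -> i != j ->
  cliff2_mx (e2 R i j) = gam i * gam j.
Proof.
move=> lti8 neij; rewrite /e2 cliff2_mx_wedge11 !sharp_dot dot_ee //.
by rewrite (negbTE neij) raddf0 addr0.
Qed.

(** The factor [1 + vol4] shows that the [de j] annihilate the spinors on which
    [vol4] is -1, as su(2) annihilates those on which it is 1. *)
Lemma cliff2_mx_de j : j \in fixed_dirs ->
  cliff2_mx (de R j) = unitq j * (1 + vol4).
Proof.
by cases_dirs; rewrite /de; [rewrite cliff2_mxD|rewrite cliff2_mxB ..];
  rewrite !cliff2_mx_e2 //;
  rewrite /vol4 mulrDr mulr1 /unitq; sort_gam; rewrite // addrC.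
Qed.

(** Of the three generators of su(2), which act as [unitq j * (1 - vol4)], one
    is enough, because [unitq 7] is invertible. *)
Lemma spin0_vol4 (psi : spinor R) : spin0 c psi -> vol4 *m psi = psi.
Proof.
have su2_34_56 : su2 (e2 R 3 4 + e2 R 5 6).
  by exists 1, 0, 0; rewrite !scale0r scale1r !addr0.
have act_34_56 : cliff2_mx (e2 R 3 4 + e2 R 5 6) = unitq 7 * (1 - vol4).
  rewrite cliff2_mxD !cliff2_mx_e2 //.
  by rewrite /vol4 mulrBr mulr1 /unitq; sort_gam.
move=> /(_ _ su2_34_56); rewrite cliff2E act_34_56 => H.
have := congr1 (mulmx (unitq 7)) H.
rewrite mulmx0 mulmxA mulmxE mulrA unitq_sqr // mulN1r mulNmx => /eqP.
by rewrite oppr_eq0 mulmxBl mul1mx subr_eq0 eq_sym => /eqP.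
Qed.

Definition imq (v : nat -> R) : 'M[R]_8 := \sum_(j <- fixed_dirs) v j *: unitq j.

Lemma imqZ s v : imq (fun j => s * v j) = s *: imq v.
Proof. by rewrite /imq scaler_sumr; apply: eq_bigr => j _; rewrite scalerA. Qed.

Lemma eq_imq u v : (forall j, j \in fixed_dirs -> u j = v j) -> imq u = imq v.
Proof. by move=> uv; apply: eq_big_seq => j jS; rewrite uv. Qed.

Lemma imq_sqr v : imq v * imq v = - (\sum_(j <- fixed_dirs) v j ^+ 2)%:M.
Proof.
rewrite /imq !big_cons !big_nil !addr0 !mulrDl !mulrDr.
rewrite -!scalerAl -!scalerAr !unitq_sqr //.
rewrite (@unitq_anticomm 2 1) // (@unitq_anticomm 7 1) // (@unitq_anticomm 7 2) //.
move: (unitq 1 * unitq 2) (unitq 1 * unitq 7) (unitq 2 * unitq 7) => A B C.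
apply/matrixP=> i k; rewrite !mxE; case: (i == k) => /=; ring.
Qed.

Lemma imq_comm (M : 'M[R]_8) v :
  (forall j, j \in fixed_dirs -> unitq j * M = M * unitq j) ->
  imq v * M = M * imq v.
Proof.
move=> unitqM; rewrite /imq mulr_suml mulr_sumr; apply: eq_big_seq => j jS.
by rewrite -scalerAl unitqM // scalerAr.
Qed.

(** * Action of the contracted 3-form *)

Definition contraction X (T : form3 R) : 'M[R]_8 := cliff2_mx (interior X T).

Lemma contraction_is_linear X : linear (contraction X : form3 R -> 'M[R]_8).
Proof. by move=> a T U; exact: cliff2_mx_is_linear. Qed.

HB.instance Definition _ X :=
  GRing.isLinear.Build R (form3 R) 'M[R]_8 *:%R (contraction X)
    (contraction_is_linear X).

(** The infinitesimal rotation given by a 2-form, seen as a commutator in the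
    Clifford algebra.  It yields the action of the 1-form Z _| b from the known
    action of b. *)
Definition commutator_rule (b : form2 R) :=
  forall Z, c Z * cliff2_mx b - cliff2_mx b * c Z = - 2 *: c (sharp (b Z)).

Lemma commutator_ruleD a b :
  commutator_rule a -> commutator_rule b -> commutator_rule (a + b).
Proof.
move=> da db Z; rewrite cliff2_mxD mulrDr mulrDl opprD addrACA da db.
have -> : sharp ((a + b) Z) = sharp (a Z) + sharp (b Z) := sharpD _ _.
by rewrite linearD scalerDr.
Qed.

Lemma commutator_ruleB a b :
  commutator_rule a -> commutator_rule b -> commutator_rule (a - b).
Proof.
move=> da db Z; rewrite cliff2_mxB mulrBr mulrBl opprD addrACA -opprD da db.
have -> : sharp ((a - b) Z) = sharp (a Z) - sharp (b Z) := sharpB _ _.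
by rewrite linearB scalerBr.
Qed.

Lemma commutator_rule_wedge11 X Y : commutator_rule (wedge11 (dot X) (dot Y)).
Proof.
move=> Z; rewrite cliff2_mx_wedge11 !sharp_dot sharp_wedge linearB !linearZ /=.
have swap U W : c U * c W = (- (2 * dot U W))%:M - c W * c U.
  by rewrite -clifford_polar addrK.
rewrite mulrDr mulrDl mulrA [c Z * c X]swap mulrBl -[c X * c Z * c Y]mulrA.
rewrite [c Z * c Y]swap [dot Z X]dotC [dot Z Y]dotC.
rewrite mulrBr mulrA -!mulmxE !mul_scalar_mx !mul_mx_scalar.
move: (c X *m c Y *m c Z) => M.
by apply/matrixP=> i j; rewrite !mxE; ring.
Qed.

Lemma commutator_rule_de j : j \in fixed_dirs -> commutator_rule (de R j).
Proof.
by cases_dirs; [apply: commutator_ruleD|apply: commutator_ruleB..];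
  exact: commutator_rule_wedge11.
Qed.

Lemma de_fixed i j X : i \in fixed_dirs -> j \in fixed_dirs ->
  de R j X (e R i) = 0.
Proof.
by cases_dirs; cases_dirs; rewrite /de !fctE /e2 /wedge11 !dot_ee //=;
  rewrite !mulr0 !mul0r; ring.
Qed.

(** The contraction of e_i /\ b with X is <e_i, X> b - e_i /\ (X _| b).  In the
    second term the wedge product is a Clifford product as soon as the two
    factors are orthogonal, which is what the hypothesis expresses. *)
Lemma contraction_wedge12 X i b : (0 < i < 8)%N -> b X (e R i) = 0 ->
  contraction X (wedge12 (dot (e R i)) b) =
    dot (e R i) X *: cliff2_mx b - gam i * c (sharp (b X)).
Proof.
move=> lti8 b0; rewrite /contraction contract_wedge12 cliff2_mxB.
rewrite cliff2_mx_wedge11 sharp_dot.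
have -> : dot (e R i) (sharp (b X)) = 0.
  case: i lti8 b0 => // i lti8 b0.
  have ->: i = Ordinal (lti8 : (i < 7)%N) by [].
  by rewrite dot_e mxE.
rewrite raddf0 addr0; congr (_ - _); exact: linearZ.
Qed.

(** For i, j, k a cyclic permutation of 1, 2, 7 the contraction is e_j /\ e_k, and
    e_i e_1 e_2 e_7 = - e_j e_k. *)
Lemma contraction_volume_fixed k : k \in fixed_dirs ->
  contraction (e R k) (wedge12 (dot (e R 1)) (e2 R 2 7)) = - (gam k * vol3).
Proof.
move=> kS; rewrite contraction_wedge12 //; last first.
  by rewrite /e2 /wedge11 !dot_ee //= mulr0 mul0r subr0.
rewrite cliff2_mx_e2 // sharp_wedge; move: kS.
cases_dirs; rewrite !dot_ee //= ?scale0r ?scale1r ?subr0 ?sub0r;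
  rewrite ?linear0 ?linearN /= -/(gam 2) -/(gam 7) /vol3 ?mulr0 ?subr0 ?sub0r; by sort_gam.
Qed.

Lemma contraction_volume_moved k : k \in moved_dirs ->
  contraction (e R k) (wedge12 (dot (e R 1)) (e2 R 2 7)) = 0.
Proof.
move=> kT; rewrite contraction_wedge12 //; last first.
  by rewrite /e2 /wedge11 !dot_ee //= mulr0 mul0r subr0.
rewrite sharp_wedge; move: kT.
cases_dirs; by rewrite !dot_ee //= !scale0r subr0 linear0 mulr0 subr0.
Qed.

Lemma sharp_de_fixed k j : k \in fixed_dirs -> j \in fixed_dirs ->
  c (sharp (de R j (e R k))) = 0.
Proof.
move=> kS jS; have := commutator_rule_de jS (e R k).
rewrite cliff2_mx_de // -/(gam k).
have -> : gam k * (unitq j * (1 + vol4)) = unitq j * (1 + vol4) * gam k.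
  rewrite mulrA -unitq_gam_fixed // -!mulrA; congr (_ * _).
  by rewrite mulrDl mulrDr mulr1 mul1r vol4_gam_fixed.
by rewrite subrr => /esym/eqP; rewrite scaler_eq0 oppr_eq0 pnatr_eq0 => /eqP.
Qed.

Section Spinor.
Variable psi : spinor R.
Hypothesis vol4_psi : vol4 *m psi = psi.

Lemma cliff2_de_psi j : j \in fixed_dirs ->
  cliff2_mx (de R j) *m psi = 2 *: (unitq j *m psi).
Proof.
move=> jS; rewrite cliff2_mx_de // -mulmxE -mulmxA mulmxDl mul1mx vol4_psi.
by rewrite mulmxDr scaler_nat mulr2n.
Qed.

(** Moving [gam k] past [de j] leaves only one term of the commutator:
    [gam k *m psi] has [vol4] eigenvalue -1 and is annihilated by [de j]. *)
Lemma sharp_de_moved k j : k \in moved_dirs -> j \in fixed_dirs ->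
  c (sharp (de R j (e R k))) *m psi = - (gam k *m (unitq j *m psi)).
Proof.
move=> kT jS; have := commutator_rule_de jS (e R k).
move/(congr1 (mulmx^~ psi)); rewrite mulmxBl -!mulmxE -!mulmxA -/(gam k).
rewrite cliff2_de_psi //.
rewrite cliff2_mx_de // -mulmxE -mulmxA mulmxDl mul1mx (mulmxA vol4).
rewrite mulmxE vol4_gam_moved // mulNmx -mulmxE -mulmxA vol4_psi.
rewrite subrr mulmx0 subr0.
rewrite -scalemxAl -scalemxAr => /(congr1 ( *:%R (- 2^-1))).
rewrite !scalerA mulrNN mulVf ?pnatr_eq0 // mulNr mulVf ?pnatr_eq0 //.
by rewrite scale1r scaleN1r.
Qed.

Lemma contraction_stated X x w : contraction X (stated_form x w) =
  \sum_(i <- fixed_dirs) \sum_(j <- fixed_dirs)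
    x i j *: contraction X (wedge12 (dot (e R i)) (de R j))
  + w *: contraction X (wedge12 (dot (e R 1)) (e2 R 2 7)).
Proof.
rewrite /stated_form linearD linearZ linear_sum; congr (_ + _).
apply: eq_bigr => i _; rewrite linear_sum; apply: eq_bigr => j _; exact: linearZ.
Qed.

Lemma fixed_dirs_range i : i \in fixed_dirs -> (0 < i < 8)%N.
Proof. by cases_dirs. Qed.

Lemma contraction_fixed k x w : k \in fixed_dirs ->
  contraction (e R k) (stated_form x w) *m psi =
  2 *: (imq (x k) *m psi) - w *: (gam k *m (vol3 *m psi)).
Proof.
move=> kS; rewrite contraction_stated contraction_volume_fixed //.
rewrite mulmxDl -scalemxAl mulNmx scalerN -mulmxE -mulmxA; congr (_ - _).
rewrite mulmx_suml (bigD1_seq k kS) //= addrC big1_seq ?add0r; last first.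
  move=> i.
  case/andP=> nik iS.
  rewrite big_seq big1 ?mul0mx // => j jS.
  rewrite contraction_wedge12 ?fixed_dirs_range ?de_fixed // sharp_de_fixed //.
  by rewrite dot_ee ?fixed_dirs_range // (negbTE nik) scale0r mulr0 subr0 scaler0.
rewrite mulmx_suml /imq mulmx_suml scaler_sumr; apply: eq_big_seq => j jS.
rewrite contraction_wedge12 ?fixed_dirs_range ?de_fixed // sharp_de_fixed //.
rewrite mulr0 subr0 dot_ee ?fixed_dirs_range // eqxx scale1r -scalemxAl.
rewrite cliff2_de_psi //.
by rewrite -scalemxAl !scalerA mulrC.
Qed.

Lemma contraction_moved k x w : k \in moved_dirs ->
  contraction (e R k) (stated_form x w) *m psi =
  - (gam k *m \sum_(i <- fixed_dirs) imq (x i) *m (gam i *m psi)).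
Proof.
move=> kT; rewrite contraction_stated contraction_volume_moved // scaler0 addr0.
have kS i : i \in fixed_dirs -> k != i by move: kT; cases_dirs; cases_dirs.
have k8 : (0 < k < 8)%N by move: kT; cases_dirs.
rewrite mulmx_suml mulmx_sumr -sumrN; apply: eq_big_seq => i iS.
rewrite mulmx_suml mulmx_suml mulmx_sumr -sumrN; apply: eq_big_seq => j jS.
rewrite contraction_wedge12 ?fixed_dirs_range ?de_fixed //.
rewrite dotC dot_ee // (negbTE (kS _ iS)) scale0r sub0r scalerN mulNmx; congr (- _).
rewrite -!scalemxAl -!scalemxAr; congr (_ *: _).
rewrite -mulmxE -mulmxA sharp_de_moved // mulmxN (mulmxA (gam i)) mulmxE.
rewrite gam_anticomm ?fixed_dirs_range 1?eq_sym ?kS // mulNmx opprK -mulmxE -mulmxA.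
by congr (_ *m _); rewrite !mulmxA mulmxE unitq_gam_fixed.
Qed.

End Spinor.

(** * The quaternionic line through an invariant spinor *)

Definition quat s v : 'M[R]_8 := s%:M + imq v.

Section Spinor2.
Variable psi : spinor R.
Hypothesis vol4_psi : vol4 *m psi = psi.
Hypothesis psi0 : psi != 0.

Lemma quat_sqr s v : quat s v * quat s v =
  quat (s ^+ 2 - \sum_(j <- fixed_dirs) v j ^+ 2) (fun j => 2 * s * v j).
Proof.
rewrite /quat mulrDl !mulrDr imq_sqr // -!mulmxE mul_scalar_mx mul_mx_scalar.
rewrite mul_scalar_mx scale_scalar_mx -expr2.
have -> : imq (fun j => 2 * s * v j) = s *: imq v + s *: imq v.
  rewrite -scalerDl /imq scaler_sumr.
  by apply: eq_bigr => j _; rewrite scalerA mulr_natl mulr2n.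
by rewrite raddfB /= [RHS]addrACA [X in _ = _ + X]addrC.
Qed.

(** A quaternion annihilating [psi] annihilates it again after multiplication by
    its conjugate, hence its norm is 0. *)
Lemma quat_free s v : quat s v *m psi = 0 ->
  s = 0 /\ forall j, j \in fixed_dirs -> v j = 0.
Proof.
move/(congr1 (mulmx (s%:M - imq v))); rewrite mulmx0 mulmxA.
have -> : (s%:M - imq v) *m quat s v =
    (s ^+ 2 + \sum_(j <- fixed_dirs) v j ^+ 2)%:M.
  rewrite mulmxE /quat mulrBl !mulrDr imq_sqr // -!mulmxE.
  rewrite !mul_scalar_mx mul_mx_scalar scale_scalar_mx -expr2 opprB addrACA subrr.
  by rewrite addr0 raddfD.
rewrite mul_scalar_mx => /eqP; rewrite scaler_eq0 (negbTE psi0) orbF.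
have ge0 : 0 <= \sum_(j <- fixed_dirs) v j ^+ 2.
  by apply: sumr_ge0 => j _; exact: sqr_ge0.
rewrite paddr_eq0 ?sqr_ge0 // sqrf_eq0 => /andP[/eqP -> v0]; split=> // j jS.
apply/eqP; rewrite -sqrf_eq0; move: v0.
rewrite psumr_eq0 => [|? _]; last exact: sqr_ge0.
by move/allP/(_ j jS).
Qed.

Lemma vol4_quat s v : vol4 * quat s v = quat s v * vol4.
Proof.
rewrite /quat mulrDr mulrDl imq_comm => [|j jS]; last by rewrite vol4_unitq.
by rewrite -!mulmxE mul_scalar_mx mul_mx_scalar.
Qed.

(** The two summands lie in different eigenspaces of [vol4]. *)
Lemma quat_gam3_free s v s' v' :
  quat s v *m psi + gam 3 *m (quat s' v' *m psi) = 0 ->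
  quat s v *m psi = 0 /\ quat s' v' *m psi = 0.
Proof.
set u := quat s v *m psi; set u' := quat s' v' *m psi => H.
have vol4_u t r : vol4 *m (quat t r *m psi) = quat t r *m psi.
  by rewrite mulmxA mulmxE vol4_quat -mulmxE -mulmxA vol4_psi.
have H' : u - gam 3 *m u' = 0.
  have := congr1 (mulmx vol4) H; rewrite mulmx0 mulmxDr vol4_u mulmxA mulmxE.
  by rewrite vol4_gam_moved // mulNmx -mulmxE -mulmxA vol4_u.
have u0 : u = 0.
  have : (u + gam 3 *m u') + (u - gam 3 *m u') = 0 by rewrite H H' addr0.
  rewrite addrACA subrr addr0 -mulr2n -scaler_nat => /eqP.
  by rewrite scaler_eq0 pnatr_eq0 => /eqP.
split=> //; move: H; rewrite u0 add0r => /(congr1 (mulmx (gam 3))).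
rewrite mulmxA mulmxE gam_sqr // mulNmx mulmx0 mul1mx => /eqP.
by rewrite oppr_eq0 => /eqP.
Qed.

(** Coordinates 0, 1, 2, 3 of a quaternion correspond to 1, [unitq 1], [unitq 2],
    [unitq 7]; [quat_orbit] has the products of these with [psi] as columns. *)
Definition quat_coef (a : 'cV[R]_4) j : R :=
  match j with
  | 1 => a (inord 1) 0
  | 2 => a (inord 2) 0
  | 7 => a (inord 3) 0
  | _ => 0
  end.

Definition quat_orbit : 'M[R]_(8, 4) :=
  \matrix_(i, j)
    ([:: psi; unitq 1 *m psi; unitq 2 *m psi; unitq 7 *m psi]`_j) i 0.

Lemma quat_orbitE a : quat_orbit *m a = quat (a 0 0) (quat_coef a) *m psi.
Proof.
apply/colP=> i; rewrite mxE !big_ord_recl big_ord0 /quat mulmxDl mul_scalar_mx.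
rewrite /imq mulmx_suml !big_cons big_nil -!scalemxAl addr0.
rewrite !mxE /= ![a _ _ * _]mulrC.
have -> : inord 1 = lift ord0 ord0 :> 'I_4 by apply: val_inj; rewrite /= inordK.
have -> : inord 2 = lift ord0 (lift ord0 ord0) :> 'I_4.
  by apply: val_inj; rewrite /= inordK.
have -> : inord 3 = lift ord0 (lift ord0 (lift ord0 ord0)) :> 'I_4.
  by apply: val_inj; rewrite /= inordK.
by rewrite addr0.
Qed.

Lemma quat_orbit_free (a : 'cV[R]_4) : quat_orbit *m a = 0 -> a = 0.
Proof.
rewrite quat_orbitE => /quat_free[a0 aS]; apply/colP=> i; rewrite mxE.
case: i => [[|[|[|[|k]]]] lti] //.
- by rewrite -[RHS]a0; congr (a _ _); apply: val_inj.
- by rewrite -[RHS](aS 1%N) //=; congr (a _ _); apply: val_inj; rewrite /= inordK.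
- by rewrite -[RHS](aS 2%N) //=; congr (a _ _); apply: val_inj; rewrite /= inordK.
- by rewrite -[RHS](aS 7%N) //=; congr (a _ _); apply: val_inj; rewrite /= inordK.
Qed.

(** The quaternionic multiples of [psi] and their images by [gam 3] are
    independent, so they fill the 8-dimensional spinor space.  A spinor fixed by
    [vol4] cannot have a component in the image of [gam 3], where [vol4] is -1. *)
Lemma quat_span phi : vol4 *m phi = phi -> exists s v, phi = quat s v *m psi.
Proof.
move=> vol4_phi.
pose M : 'M[R]_(8, 4 + 4) := row_mx quat_orbit (gam 3 *m quat_orbit).
have ME a : M *m a = quat_orbit *m usubmx a + gam 3 *m (quat_orbit *m dsubmx a).
  by rewrite -[a in LHS]vsubmxK mul_row_col mulmxA.
have Mfree : (M : 'M_8)^T \in unitmx.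
  rewrite -row_free_unit; apply: inj_row_free => v vM.
  have : M *m (v^T : 'cV_(4 + 4)) = 0.
    by rewrite -[LHS]trmxK trmx_mul trmxK vM trmx0.
  rewrite ME !quat_orbitE => /quat_gam3_free[]; rewrite -!quat_orbitE.
  move=> /quat_orbit_free u0 /quat_orbit_free d0.
  apply: trmx_inj; rewrite trmx0 -[LHS](@vsubmxK _ 4 4) u0 d0.
  exact: (@col_mx0 _ 4 4).
rewrite unitmx_tr in Mfree.
have [a phiE] : exists a : 'cV_(4 + 4), phi = M *m a.
  by exists (invmx (M : 'M_8) *m phi); rewrite mulKVmx.
exists (usubmx a 0 0), (quat_coef (usubmx a)); rewrite -quat_orbitE.
have vol4_orbit (b : 'cV[R]_4) : vol4 *m (quat_orbit *m b) = quat_orbit *m b.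
  by rewrite quat_orbitE mulmxA mulmxE vol4_quat -mulmxE -mulmxA vol4_psi.
have := vol4_phi; rewrite phiE ME mulmxDr vol4_orbit mulmxA mulmxE.
rewrite vol4_gam_moved // mulNmx -mulmxE -mulmxA vol4_orbit => /addrI /eqP.
rewrite eq_sym -addr_eq0 -mulr2n -scaler_nat scaler_eq0 pnatr_eq0 /= => /eqP ->.
by rewrite addr0.
Qed.

Lemma quat_inj s v t r : quat s v *m psi = quat t r *m psi ->
  s = t /\ forall j, j \in fixed_dirs -> v j = r j.
Proof.
move=> H; have : quat (s - t) (fun j => v j - r j) *m psi = 0.
  rewrite /quat raddfB /=.
  have -> : imq (fun j => v j - r j) = imq v - imq r.
    by rewrite /imq -sumrB; apply: eq_bigr => j _; rewrite scalerBl.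
  by rewrite addrACA -opprD mulmxBl -/(quat s v) -/(quat t r) H subrr.
case/quat_free => /eqP; rewrite subr_eq0 => /eqP -> vr; split=> // j /vr /eqP.
by rewrite subr_eq0 => /eqP.
Qed.

(** Since M commutes with the quaternions, M (q psi) = q (M psi) = q^2 psi.
    The two last conditions say that the real and imaginary parts of q^2 are [a]
    and 0. *)
Lemma commutant_quat (M : 'M[R]_8) (a : R) : vol4 * M = M * vol4 ->
    (forall j, j \in fixed_dirs -> unitq j * M = M * unitq j) -> M * M = a%:M ->
  exists s v, [/\ M *m psi = quat s v *m psi,
    s ^+ 2 - \sum_(j <- fixed_dirs) v j ^+ 2 = a
    & forall j, j \in fixed_dirs -> s * v j = 0].
Proof.
move=> vol4M unitqM MM.
have [|s [v psiM]] := @quat_span (M *m psi).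
  by rewrite mulmxA mulmxE vol4M -mulmxE -mulmxA vol4_psi.
exists s, v.
have : quat s v * quat s v *m psi = a%:M *m psi.
  rewrite -MM -!mulmxE -!mulmxA -psiM [X in _ = M *m X]psiM !mulmxA.
  congr (_ *m _); rewrite !mulmxE /quat mulrDr mulrDl imq_comm // -!mulmxE.
  by rewrite mul_scalar_mx mul_mx_scalar.
have -> : a%:M = quat a (fun=> 0).
  by rewrite /quat /imq big1 ?addr0 // => j _; rewrite scale0r.
rewrite quat_sqr => /quat_inj[sa v0]; split=> // j /v0 /eqP.
by rewrite -mulrA mulf_eq0 pnatr_eq0 => /eqP.
Qed.

End Spinor2.

(** * Solving for the coefficients *)

Lemma contraction_linearl (T : form3 R) a X Y : is_form3 T ->
  contraction (a *: X + Y) T = a *: contraction X T + contraction Y T.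
Proof.
case=> TX _ _ _ _; rewrite /contraction -cliff2_mx_is_linear; congr cliff2_mx.
by apply/funext=> U; apply/funext=> W; rewrite /interior TX.
Qed.

Definition kills (T : form3 R) psi X :=
  cliff1 c X psi - cliff2 c (2 *: interior X T) psi = 0.

Lemma killsE T psi X : kills T psi X <->
  c X *m psi = 2 *: (contraction X T *m psi).
Proof.
rewrite /kills /cliff1 cliff2E.
have -> : cliff2_mx (2 *: interior X T) = 2 *: contraction X T by exact: linearZ.
by rewrite -scalemxAl; split=> [/eqP|->]; rewrite ?subrr // subr_eq0 => /eqP.
Qed.

Lemma kills_basis T psi : is_form3 T ->
  (forall k, (0 < k < 8)%N -> kills T psi (e R k)) -> forall X, kills T psi X.
Proof.
move=> T3 Te X; rewrite [X]vec_sum_e big_seq.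
have comb a Y Z : kills T psi Y -> kills T psi Z -> kills T psi (a *: Y + Z).
  move=> /killsE KY /killsE KZ; apply/killsE.
  rewrite contraction_linearl // linearP !mulmxDl -!scalemxAl KY KZ.
  by rewrite scalerDr !scalerA mulrC.
elim/big_rec: _ => [|k Y]; last by rewrite mem_index_iota => k8; apply/comb/Te.
apply/killsE.
have -> : (0 : vec R) = -1 *: e R 1 + e R 1 by rewrite scaleN1r addNr.
rewrite contraction_linearl // scaleN1r !addNr linear0 mul0mx.
by rewrite scaleN1r addNr mul0mx scaler0.
Qed.

Section Spinor3.
Variable psi : spinor R.
Hypothesis vol4_psi : vol4 *m psi = psi.
Hypothesis psi0 : psi != 0.
Variables (a : nat -> nat -> R) (eps : R).
Hypothesis eps1 : eps ^+ 2 = 1.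
Hypothesis vol3_psi : vol3 *m psi = eps *: psi.
Hypothesis gam_psi : forall i, i \in fixed_dirs -> gam i *m psi = imq (a i) *m psi.
Hypothesis a1 : forall i, i \in fixed_dirs -> \sum_(j <- fixed_dirs) a i j ^+ 2 = 1.

Lemma kills_fixedE x w k : k \in fixed_dirs ->
  kills (stated_form x w) psi (e R k) <->
  forall j, j \in fixed_dirs -> 4 * x k j = (1 + 2 * w * eps) * a k j.
Proof.
move=> kS; rewrite killsE contraction_fixed // vol3_psi -scalemxAr !scalerA.
rewrite -/(gam k) gam_psi //.
rewrite scalerBr !scalerA (_ : 2 * 2 = 4 :> R); last by ring.
have imqZpsi s v : imq (fun j => s * v j) *m psi = s *: (imq v *m psi).
  by rewrite imqZ scalemxAl.
split=> [H j jS|H].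
  have : quat 0 (fun j => 4 * x k j) *m psi =
         quat 0 (fun j => (1 + 2 * w * eps) * a k j) *m psi.
    rewrite /quat raddf0 !add0r !imqZpsi [RHS]scalerDl scale1r {1}H.
    by rewrite -mulrA subrK.
  by case/(quat_inj psi0) => _ /(_ j jS).
by rewrite -imqZpsi (eq_imq H) imqZpsi scalerDl scale1r mulrA addrK.
Qed.

(** The imaginary quaternion [imq (a i)] stands for [gam i] on [psi].  The
    invertible factor [gam k] cancels, so the condition does not depend on k. *)
Lemma kills_movedE x w k : k \in moved_dirs ->
  kills (stated_form x w) psi (e R k) <->
  psi = - 2 *: \sum_(i <- fixed_dirs) imq (x i) *m (imq (a i) *m psi).
Proof.
move=> kT; rewrite killsE contraction_moved // -/(gam k).
have -> : \sum_(i <- fixed_dirs) imq (x i) *m (gam i *m psi) =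
    \sum_(i <- fixed_dirs) imq (x i) *m (imq (a i) *m psi).
  by apply: eq_big_seq => i iS; rewrite gam_psi.
have k8 : (0 < k < 8)%N by move: kT; cases_dirs.
rewrite scalerN -scaleNr scalemxAr; split=> [/(congr1 (mulmx (gam k)))|{1}->] //.
rewrite !mulmxA mulmxE gam_sqr // !mulNmx !mul1mx => /oppr_inj //.
Qed.

(** The fixed directions give x = t a with t = (1 + 2 w eps) / 4.  As each
    [imq (a i)] has square -1, the moved directions give 6 t = 1. *)
Lemma kills_statedE x w :
  (forall X, kills (stated_form x w) psi X) <->
  (forall i j, i \in fixed_dirs -> j \in fixed_dirs -> x i j = a i j / 6) /\
  w = - eps / 6.
Proof.
have sum_imq2 t :
    (forall i j, i \in fixed_dirs -> j \in fixed_dirs -> x i j = t * a i j) ->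
    \sum_(i <- fixed_dirs) imq (x i) *m (imq (a i) *m psi) = - (3 * t) *: psi.
  move=> xa.
  have -> : \sum_(i <- fixed_dirs) imq (x i) *m (imq (a i) *m psi) =
      \sum_(i <- fixed_dirs) (- t *: psi).
    apply: eq_big_seq => i iS.
    rewrite (@eq_imq _ (fun j => t * a i j)) => [|j jS]; last exact: xa.
    rewrite imqZ mulmxA -scalemxAl mulmxE imq_sqr // a1 //.
    by rewrite scalerN scale_scalar_mx mulr1 mulNmx mul_scalar_mx scaleNr.
  by rewrite !big_cons big_nil addr0 -!scalerDl; congr (_ *: _); ring.
split=> [H|[xa ->]].
  have xa i j : i \in fixed_dirs -> j \in fixed_dirs ->
      x i j = (1 + 2 * w * eps) / 4 * a i j.
    move=> iS jS; have /(kills_fixedE _ _ iS)/(_ j jS) := H (e R i) => E4.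
    by rewrite mulrAC -E4; field.
  have /(kills_movedE x w (k := 3) isT) := H (e R 3).
  rewrite (sum_imq2 _ xa) scalerA => /eqP.
  rewrite -subr_eq0 -{1}[psi]scale1r -scalerBl.
  rewrite scaler_eq0 (negbTE psi0) orbF => /eqP t6.
  (* t6 says 1 = 6 t with t = (1 + 2 w eps) / 4. *)
  have weps : w * eps = - 1 / 6 by move: t6; lra.
  split=> [i j iS jS|]; first by rewrite xa // -[2 * w * eps]mulrA weps; field.
  by rewrite -[LHS]mulr1 -[X in _ * X = _]eps1 expr2 mulrA weps; field.
have xa' i j : i \in fixed_dirs -> j \in fixed_dirs -> x i j = 6^-1 * a i j.
  by move=> *; rewrite xa // mulrC.
apply: kills_basis => [|k k8]; first exact: is_form3_stated.
have /orP[kS|kT] : (k \in fixed_dirs) || (k \in moved_dirs).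
- by case: k k8 => [|[|[|[|[|[|[|[|k]]]]]]]].
- apply/kills_fixedE => // j jS; rewrite xa //.
  have -> : 2 * (- eps / 6) * eps = - (eps ^+ 2) / 3 by field.
  by rewrite eps1; field.
- apply/kills_movedE => //; rewrite (sum_imq2 _ xa') scalerA.
  by rewrite -[LHS]scale1r; congr (_ *: _); field.
Qed.

End Spinor3.

(** A quaternion with square -1 is purely imaginary of norm 1. *)
Lemma fixed_coef (psi : spinor R) : vol4 *m psi = psi -> psi != 0 ->
  exists a : nat -> nat -> R, forall i, i \in fixed_dirs ->
    gam i *m psi = imq (a i) *m psi /\ \sum_(j <- fixed_dirs) a i j ^+ 2 = 1.
Proof.
move=> vol4_psi psi0.
have coef i : exists v, i \in fixed_dirs ->
    gam i *m psi = imq v *m psi /\ \sum_(j <- fixed_dirs) v j ^+ 2 = 1.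
  have [iS|//] := boolP (i \in fixed_dirs); last by exists (fun=> 0).
  have [||| s [v [gv sv s0]]] :=
    commutant_quat vol4_psi psi0 (M := gam i) (a := -1).
  - exact: vol4_gam_fixed.
  - by move=> j jS; exact: unitq_gam_fixed.
  - by rewrite gam_sqr ?fixed_dirs_range // raddfN.
  have s00 : s = 0.
    (* If s <> 0 then v = 0, and s ^+ 2 would be -1. *)
    apply: contra_eq sv => sn0; rewrite big_seq big1 ?subr0 => [|j jS].
      by rewrite gt_eqF // (lt_le_trans _ (sqr_ge0 s)) // oppr_lt0 ltr01.
    move/eqP: (s0 j jS); rewrite mulf_eq0 (negbTE sn0) => /eqP ->.
    by rewrite expr0n.
  exists v => _; split; first by rewrite gv s00 /quat raddf0 add0r.
  by move: sv; rewrite s00 expr0n sub0r => /oppr_inj.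
by have [a aP] := choice coef; exists a.
Qed.

(** A quaternion with square 1 is real, hence 1 or -1.  The sign depends on which
    of the two Clifford modules is used. *)
Lemma vol3_sign (psi : spinor R) : vol4 *m psi = psi -> psi != 0 ->
  exists2 eps : R, eps ^+ 2 = 1 & vol3 *m psi = eps *: psi.
Proof.
move=> vol4_psi psi0.
have [||| s [v [Nv sv s0]]] :=
  commutant_quat vol4_psi psi0 (M := vol3) (a := 1).
- exact: vol4_vol3.
- exact: unitq_vol3.
- exact: vol3_sqr.
have sn0 : s != 0.
  apply: contra_eq_neq sv => ->; rewrite expr0n sub0r lt_eqF //.
  rewrite (le_lt_trans _ ltr01) // oppr_le0; apply: sumr_ge0 => j _; exact: sqr_ge0.
have v0 j : j \in fixed_dirs -> v j = 0.
  by move/s0/eqP; rewrite mulf_eq0 (negbTE sn0) => /eqP.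
exists s; first by rewrite -sv big_seq big1 ?subr0 // => j /v0 ->; rewrite expr0n.
(* Writing the zero coefficients as 0 * 0 lets imqZ take out a factor 0. *)
rewrite Nv /quat (@eq_imq _ (fun=> 0 * 0)) => [|j /v0 ->]; last by rewrite mulr0.
by rewrite imqZ scale0r addr0 mul_scalar_mx.
Qed.

End Clifford.

Theorem proposition9p1 (R : realType) (c : {linear vec R -> 'M[R]_8})
    (hc : is_clifford c) (psi : spinor R) (hpsi : spin0 c psi)
    (hpsi0 : psi <> 0) :
  exists! T : form3 R,
    [/\ is_form3 T, has_stated_type T
      & forall X : vec R,
          cliff1 c X psi - cliff2 c (2 *: interior X T) psi = 0].
Proof.
have vol4_psi := spin0_vol4 hc hpsi; have psi0 : psi != 0 by apply/eqP.
have [a aP] := fixed_coef hc vol4_psi psi0.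
have [eps eps1 vol3_psi] := vol3_sign hc vol4_psi psi0.
have main := kills_statedE hc vol4_psi psi0 eps1 vol3_psi
  (fun i iS => (aP i iS).1) (fun i iS => (aP i iS).2).
exists (stated_form (fun i j => a i j / 6) (- eps / 6)); split.
  split; [exact: is_form3_stated | | exact/main].
  by exists (fun i j => a i j / 6), (- eps / 6).
move=> _ [_ [x [w ->]] /main[xa ->]]; congr (_ + _).
by apply: eq_big_seq => i iS; apply: eq_big_seq => j jS; rewrite xa.
Qed.
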